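(* Let $n\ge 2$ and let $X=(X_1,\dots,X_n)$ be a random vector in $\{\pm1\}^n$. Then $X$ can be embedded in a probability space (that is, there is a probability space carrying a random vector with the same law as $X$, again denoted $X$) such that for any $\ell\in[n]$ there exists a $\sigma$-algebra $\Sigma$ (a sub-$\sigma$-algebra of that probability space) which satisfies $$\mathbb{E}\left[\mathbb{E}_{\{u,v\}\in\binom{[n]}{2}}\left[\mathrm{Cov}(X_u,X_v\mid\Sigma)^2\right]\right]\le\frac{1}{\ell}$$ and $$H(X)-H(X\mid\Sigma)\le \ell.$$
   Context: $[n]=\{1,\dots,n\}$. $\mathbb{E}_{\{u,v\}\in\binom{[n]}{2}}$ denotes the average over a uniformly random unordered pair of distinct elements of $[n]$. $\mathrm{Cov}(X_u,X_v\mid\Sigma)=\mathbb{E}[X_uX_v\mid\Sigma]-\mathbb{E}[X_u\mid\Sigma]\,\mathbb{E}[X_v\mid\Sigma]$ is the conditional covariance. For a random vector $X$ in $\{\pm1\}^n$ with law $\mu$, $H(X)=-\int\log\left(\frac{d\mu}{d\nu}\right)d\mu$, where $\nu$ is the uniform probability measure on $\{\pm1\}^n$ and $\log$ is natural; $H(X\mid\Sigma)$ is the conditional entropy, i.e. the expectation of the entropy (with respect to $\nu$) of the conditional law of $X$ given $\Sigma$. *)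

(* Defs.v *)
From HB Require Import structures.
From mathcomp Require Import all_boot all_order all_algebra.
From mathcomp Require Import all_classical all_reals all_analysis.
From mathcomp Require Import finmap measurable_realfun.

Set Implicit Arguments.
Unset Strict Implicit.
Unset Printing Implicit Defensive.

Import Order.TTheory GRing.Theory Num.Theory.
Import numFieldNormedType.Exports.

Local Open Scope classical_set_scope.
Local Open Scope ring_scope.
Local Open Scope charge_scope.

Section condexp.
Context d (T : measurableType d) (R : realType) (P : probability T R).
Implicit Types (Sigma : set_system T) (f g : T -> R).

Definition is_sub_sigma_algebra Sigma :=
  sigma_algebra [set: T] Sigma /\ Sigma `<=` measurable.

Definition is_condexp Sigma f g :=
  [/\ measurable_fun [set: g_sigma_algebraType Sigma] g,
      P.-integrable [set: T] (EFin \o g) &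
      forall A, Sigma A ->
        (\int[P]_(w in A) (g w)%:E = \int[P]_(w in A) (f w)%:E)%E].

(* An arbitrary version; existence is condexpP and a.s. uniqueness is
   condexp_ae_eq, so only the a.s. class of the chosen version matters. *)
Definition condexp Sigma f : T -> R := get [set g | is_condexp Sigma f g].

Definition condcov Sigma (Y Z : T -> R) (w : T) : R :=
  condexp Sigma (Y \* Z) w - condexp Sigma Y w * condexp Sigma Z w.

(* Regular conditional law of X given Sigma: k w A is a version of
   P(X \in A | Sigma). It exists for X valued in the discrete cube (condlawP). *)
Definition is_condlaw Sigma d' (S : measurableType d') (X : T -> S)
    (k : T -> probability S R) :=
  forall A, measurable A -> is_condexp Sigma \1_(X @^-1` A) (fun w => fine (k w A)).

Definition condlaw Sigma d' (S : measurableType d') (X : T -> S) :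
  T -> probability S R := get [set k | is_condlaw Sigma X k].

End condexp.

Section condexp_theory.
Context d (T : measurableType d) (R : realType) (P : probability T R).
Variable Sigma : set_system T.
Hypothesis subSigma : is_sub_sigma_algebra Sigma.
Implicit Types f g : T -> R.

Local Notation S := (g_sigma_algebraType Sigma).

Let mSP (A : set S) : measurable A <-> Sigma A.
Proof. by rewrite -[X in _ <-> X _](measurable_g_measurableTypeE subSigma.1). Qed.

Let mSW (A : set S) : measurable A -> d.-measurable A.
Proof. by move=> /mSP; exact: subSigma.2. Qed.

Let idS : T -> S := idfun.

Let midS : measurable_fun [set: T] idS.
Proof. by move=> _ A mA; rewrite setTI; exact: mSW. Qed.

HB.instance Definition _ := isMeasurableFun.Build _ _ _ _ idS midS.

Let PS : probability S R := distribution P idS.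

Let mfunW g : measurable_fun [set: S] g -> measurable_fun [set: T] g.
Proof. by move=> mg _ A mA; apply: mSW; exact: mg. Qed.

Let intPS (D : set S) g : measurable D -> measurable_fun [set: S] g ->
  P.-integrable [set: T] (EFin \o g) ->
  PS.-integrable D (EFin \o (g : S -> R)) /\
  (\int[PS]_(w in D) (g w)%:E = \int[P]_(w in (D : set T)) (g w)%:E)%E.
Proof.
move=> mD mg ig.
have mDT : d.-measurable D by exact: mSW.
have igD : P.-integrable (idS @^-1` D) ((EFin \o (g : S -> R)) \o idS).
  exact: integrableS ig.
have mEg : measurable_fun [set: S] (EFin \o (g : S -> R)) by exact/measurable_EFinP.
split; first exact: integrable_pushforward.
exact: (integral_pushforward midS mEg igD mD).
Qed.

Lemma condexp_ae_eq f g g' : is_condexp P Sigma f g -> is_condexp P Sigma f g' ->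
  {ae P, forall w, g w = g' w}.
Proof.
move=> [mg ig eg] [mg' ig' eg'].
have emg' : measurable_fun [set: S] (EFin \o (g' : S -> R)) by exact/measurable_EFinP.
have : ae_eq PS setT (EFin \o (g : S -> R)) (EFin \o (g' : S -> R)).
  apply: integral_ae_eq => //; first by have [] := intPS measurableT mg ig.
  move=> E _ mE; have [_ gE] := intPS mE mg ig; have [_ g'E] := intPS mE mg' ig'.
  by rewrite [LHS]gE [RHS]g'E eg ?eg'//; exact/mSP.
move=> [N [mN N0 subN]]; exists N; split => //; first exact: mSW.
apply: subset_trans subN => w /= gw; apply: contra_not gw => H.
by have [] := H I.
Qed.

Lemma condexp_exists f : P.-integrable [set: T] (EFin \o f) ->
  exists g, is_condexp P Sigma f g.
Proof.
move=> intf.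
pose nu := measure_function_pushforward__canonical__charge_Charge (induced_charge intf) midS.
have nuP : nu `<< PS.
  apply/null_content_dominatesP => A mA PA.
  apply: null_set_integral => //; first exact: mSW.
  by apply: measurable_funTS; exact: measurable_int intf.
pose RN := 'd nu '/d PS.
have RNE : EFin \o (fine \o RN) = RN.
  by apply/funext => w /=; rewrite fineK//; exact: Radon_Nikodym_fin_num.
have iRN : PS.-integrable setT RN by exact: Radon_Nikodym_integrable.
have mRN : measurable_fun [set: S] RN by exact: measurable_int iRN.
have iRNT : P.-integrable [set: T] RN.
  apply/integrableP; split.
    by move=> _ B mB; apply: mSW; exact: mRN.
  have /integrableP[_] := iRN.
  by rewrite ge0_integral_pushforward//; exact: measurableT_comp.
exists (fine \o RN); split.
- by apply/measurable_EFinP; rewrite [X in measurable_fun _ X]RNE.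
- by rewrite RNE.
- move=> A /mSP mA.
  have mg : measurable_fun [set: S] (fine \o RN).
    by apply/measurable_EFinP; rewrite [X in measurable_fun _ X]RNE.
  have ig : P.-integrable [set: T] (EFin \o (fine \o RN)) by rewrite RNE.
  have [_ <-] := intPS mA mg ig.
  have /= := Radon_Nikodym_integral nuP mA.
  rewrite /induced_charge /pushforward /= => ->.
  by apply: eq_integral => w _; rewrite fineK//; exact: Radon_Nikodym_fin_num.
Qed.

Lemma condexpP f : P.-integrable [set: T] (EFin \o f) ->
  is_condexp P Sigma f (condexp P Sigma f).
Proof. by move=> /condexp_exists; exact: getPex. Qed.

Lemma is_condexp_ge0 f g : is_condexp P Sigma f g -> (forall w, 0 <= f w) ->
  {ae P, forall w, 0 <= g w}.
Proof.
move=> [mg ig eg] f0.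
pose A : set S := [set w | g w < 0].
have mA : measurable A.
  have := mg measurableT _ (measurable_itv `]-oo, 0[).
  by rewrite setTI; congr measurable; apply/seteqP; split => w /=; rewrite in_itv.
have [igA _] := intPS mA mg ig.
have : ae_eq PS A (EFin \o (g : S -> R)) (cst 0%E).
  apply: integral_ae_eq => // E EA mE.
  have [_ gE] := intPS mE mg ig.
  rewrite [RHS]integral0; apply/eqP; rewrite eq_le; apply/andP; split.
    rewrite -oppe_ge0 -integralN; last first.
      by exact: (integrable_add_def mE (integrableS mA mE EA igA)).
    by apply: integral_ge0 => w /EA /ltW; rewrite -EFinN lee_fin oppr_ge0.
  rewrite [leRHS]gE eg; last exact/mSP.
  by apply: integral_ge0 => w _; rewrite lee_fin.
move=> [N [mN N0 subN]]; exists N; split => //; first exact: mSW.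
apply: subset_trans subN => w /= gw; apply: contra_not gw => H.
rewrite leNgt; apply/negP => gw0; have [gw1] := H gw0.
by rewrite gw1 ltxx in gw0.
Qed.

Lemma is_condexp_ae f g g' : is_condexp P Sigma f g ->
  measurable_fun [set: S] g' -> {ae P, forall w, g w = g' w} ->
  is_condexp P Sigma f g'.
Proof.
move=> [mg ig eg] mg' gg'.
have gg'E D : ae_eq P D (EFin \o g) (EFin \o g').
  by apply: filterS gg' => w /= ->.
have mgT : measurable_fun [set: T] (EFin \o g) by exact/measurable_EFinP/mfunW.
have mgT' : measurable_fun [set: T] (EFin \o g') by exact/measurable_EFinP/mfunW.
split => //.
- apply/integrableP; split => //.
    have /integrableP[_] := ig; congr (_ < _)%E; apply: ae_eq_integral => //.
    - exact: measurableT_comp.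
    - exact: measurableT_comp.
    - exact/ae_eq_abse/gg'E.
- move=> A SA; rewrite -eg//; apply: ae_eq_integral.
  + exact: subSigma.2.
  + exact: measurable_funTS.
  + exact: measurable_funTS.
  + exact/ae_eq_sym/gg'E.
Qed.

Lemma is_condexp_sum (I : finType) (c : I -> R) (f g : I -> T -> R) :
  (forall i, P.-integrable [set: T] (EFin \o f i)) ->
  (forall i, is_condexp P Sigma (f i) (g i)) ->
  is_condexp P Sigma (fun w => \sum_i c i * f i w) (fun w => \sum_i c i * g i w).
Proof.
move=> intf fg.
have EsumE (h : I -> T -> R) : EFin \o (fun w => \sum_i c i * h i w) =
    (fun w => \sum_i (c i)%:E * (h i w)%:E)%E.
  by apply/funext => w /=; rewrite -sumEFin.
have iZ (h : I -> T -> R) i : P.-integrable [set: T] (EFin \o h i) ->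
    P.-integrable [set: T] (fun w => (c i)%:E * (h i w)%:E)%E.
  by move=> ih; exact: (integrableZl measurableT _ ih).
have intg i : P.-integrable [set: T] (EFin \o g i) by have [] := fg i.
have sumE (h : I -> T -> R) D : measurable D ->
    (forall i, P.-integrable [set: T] (EFin \o h i)) ->
    (\int[P]_(w in D) (\sum_i c i * h i w)%:E =
     \sum_i (c i)%:E * \int[P]_(w in D) (h i w)%:E)%E.
  move=> mD ih; rewrite (eq_integral (fun w => \sum_i (c i)%:E * (h i w)%:E)%E).
    rewrite integral_sum//; last by move=> i; apply: integrableS (iZ _ _ (ih i)).
    by apply: eq_bigr => i _; rewrite integralZl//; exact: integrableS (ih i).
  by move=> w _; rewrite -sumEFin.
split.
- apply: measurable_sum => i; apply: measurable_funM; first exact: measurable_cst.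
  by have [] := fg i.
- by rewrite EsumE; apply: integrable_sum => // i _; exact: iZ.
- move=> A SA; have mA : measurable A by exact: subSigma.2.
  rewrite !sumE//; apply: eq_bigr => i _; congr (_ * _)%E.
  by have [_ _] := fg i; exact.
Qed.

End condexp_theory.

(* {-1, 1}^n, encoded by sign bits (see spin: true is -1, false is 1). Its
   measurable structure is the discrete one (measurable_cube). *)
Notation cube n := (n.-tuple bool).

Section cube.
Context (n : nat).

Lemma measurable_cube (A : set (cube n)) : measurable A.
Proof.
have m1 (x : cube n) : measurable [set x].
  have -> : [set x] =
      \bigcap_(i in [set: 'I_n]) ((@tnth n bool)^~ i @^-1` [set tnth x i]).
    apply/seteqP; split => [_ -> i _ //|y xy].
    by apply: eq_from_tnth => i; exact: xy.
  apply: fin_bigcap_measurable => [|i _]; first exact: finite_finset.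
  by rewrite -[X in measurable X]setTI; exact: measurable_tnth.
have -> : A = \bigcup_(x in A) [set x].
  by apply/seteqP; split => [x Ax|x [y Ay ->]//]; exists x.
by apply: fin_bigcup_measurable => //; exact: finite_finset.
Qed.

End cube.

Section weight_law.
Context (R : realType) (n : nat) (q : cube n -> R).
Hypotheses (q0 : forall x, 0 <= q x) (q1 : \sum_x q x = 1).

Let x_ i : cube n := nth point (enum {: cube n}) i.

Let weight_law : set (cube n) -> \bar R :=
  msum (fun i => mscale (NngNum (q0 (x_ i))) (dirac (x_ i))) #|{: cube n}|.

Let weight_lawE A : weight_law A = (\sum_x q x * \1_A x)%:E.
Proof.
rewrite /weight_law /= /msum /mscale /= -sumEFin.
have -> : (\sum_x (q x * \1_A x)%:E)%E =
    (\sum_(x <- enum {: cube n}) (q x * \1_A x)%:E)%E by rewrite big_enum.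
rewrite (big_nth point) -cardT big_mkord.
by apply: eq_bigr => i _; rewrite /mscale /dirac.
Qed.

HB.instance Definition _ := Measure.on weight_law.

Let weight_law1 : weight_law [set: _] = 1%E.
Proof.
rewrite weight_lawE -[RHS]/(1%:E) -q1; congr EFin.
by apply: eq_bigr => x _; rewrite indicE in_setT mulr1.
Qed.

HB.instance Definition _ :=
  Measure_isProbability.Build _ _ _ weight_law weight_law1.

Lemma weight_law_exists :
  exists mu : probability (cube n) R, forall A, mu A = (\sum_x q x * \1_A x)%:E.
Proof. by exists weight_law => A; exact: weight_lawE. Qed.

End weight_law.

Section condlaw_theory.
Context d (T : measurableType d) (R : realType) (P : probability T R).
Context (n : nat) (X : T -> cube n) (Sigma : set_system T).
Hypotheses (mX : measurable_fun [set: T] X) (subSigma : is_sub_sigma_algebra Sigma).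

Local Notation S := (g_sigma_algebraType Sigma).

Let mXA A : measurable (X @^-1` A).
Proof. by rewrite -[X in measurable X]setTI; apply: mX => //; exact: measurable_cube. Qed.

Let intX A : P.-integrable [set: T] (EFin \o \1_(X @^-1` A)).
Proof.
by apply: integrable_indic => //; rewrite setIT.
Qed.

Let g x := condexp P Sigma \1_(X @^-1` [set x]).

Let gP x : is_condexp P Sigma \1_(X @^-1` [set x]) (g x).
Proof. exact: condexpP. Qed.

Let indX (c : cube n -> R) w : \sum_x c x * \1_(X @^-1` [set x]) w = c (X w).
Proof.
rewrite (bigD1 (X w)) //= big1 => [|x xX]; last first.
  by rewrite indicE memNset ?mulr0//= => /esym/eqP; rewrite (negbTE xX).
by rewrite addr0 indicE mem_set ?mulr1.
Qed.

Let sum_g1 : {ae P, forall w, \sum_x g x w = 1}.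
Proof.
have H := is_condexp_sum subSigma (fun=> 1) (fun x => intX [set x]) gP.
have H1 : is_condexp P Sigma (fun w => \sum_x 1 * \1_(X @^-1` [set x]) w) (cst 1).
  split; first exact: measurable_cst.
    exact: finite_measure_integrable_cst.
  by move=> A SA; apply: eq_integral => w _; rewrite (indX (fun=> 1)).
have := condexp_ae_eq subSigma H H1.
by apply: filterS => w /= <-; apply: eq_bigr => x _; rewrite mul1r.
Qed.

Let g_ge0 : {ae P, forall w, forall x, 0 <= g x w}.
Proof.
have H x : {ae P, forall w, 0 <= g x w}.
  exact: (is_condexp_ge0 subSigma (gP x)).
exact: filter_forall.
Qed.

Let good : set S := [set w | (forall x, 0 <= g x w) /\ \sum_x g x w = 1].

Let mgood : measurable good.
Proof.
have -> : good = (\bigcap_(x in [set: cube n]) (g x @^-1` `[0, +oo[)) `&`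
    (fun w => \sum_x g x w) @^-1` [set 1].
  apply/seteqP; split => w [H1 H2]; split => // x.
    by move=> _ /=; rewrite in_itv /= H1.
  by have := H1 x I; rewrite /= in_itv /= andbT.
apply: measurableI.
  apply: fin_bigcap_measurable => [|x _]; first exact: finite_finset.
  rewrite -[X in measurable X]setTI.
  by have [mg _ _] := gP x; exact: mg.
rewrite -[X in measurable X]setTI.
have : measurable_fun [set: S] (fun w => \sum_x g x w).
  by apply: measurable_sum => x; have [] := gP x.
exact.
Qed.

Let x0 : cube n := point.

Let q w x : R := if w \in good then g x w else (x == x0)%:R.

Let q0 w x : 0 <= q w x.
Proof. by rewrite /q; case: ifPn => // /set_mem[]. Qed.

Let q1 w : \sum_x q w x = 1.
Proof.
rewrite /q; have [/set_mem[]//|_] := boolP (w \in good).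
by rewrite (bigD1 x0)//= eqxx big1 ?addr0// => x /negbTE ->.
Qed.

Let k w : probability (cube n) R := sval (cid (weight_law_exists (q0 w) (q1 w))).

Let kE w A : k w A = (\sum_x q w x * \1_A x)%:E.
Proof. by rewrite /k; case: cid. Qed.

Let mq x : measurable_fun [set: S] (fun w => q w x).
Proof.
apply: measurable_fun_ifT; last exact: measurable_cst.
  by apply: (measurable_fun_bool true); rewrite setTI preimage_mem_true.
by have [] := gP x.
Qed.

Lemma condlaw_exists : exists k, is_condlaw P Sigma X k.
Proof.
exists k => A mA.
have H := is_condexp_sum subSigma \1_A (fun x => intX [set x]) gP.
have : is_condexp P Sigma (fun w => \sum_x \1_A x * \1_(X @^-1` [set x]) w)
    (fun w => fine (k w A)).
  apply: (is_condexp_ae subSigma H).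
    rewrite (_ : (fun w => fine (k w A)) = (fun w => \sum_x q w x * \1_A x)).
      apply: measurable_sum => x; apply: measurable_funM.
        exact: mq.
      exact: measurable_cst.
    by apply/funext => w; rewrite kE.
  apply: filterS2 sum_g1 g_ge0 => w w1 w0.
  rewrite kE /=; apply: eq_bigr => x _; rewrite mulrC /q mem_set//.
by rewrite (_ : (fun w => \sum_x _) = \1_(X @^-1` A))//; apply/funext => w; rewrite indX.
Qed.

Lemma condlawP : is_condlaw P Sigma X (condlaw P Sigma X).
Proof. exact: (getPex condlaw_exists). Qed.

End condlaw_theory.

Section entropy.
Context (R : realType) (n : nat).

Definition uniform_cube : set (cube n) -> \bar R :=
  mscale (((2 ^ n)%:R : R)^-1)%:nng counting.

HB.instance Definition _ := Measure.on uniform_cube.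

Let uniform_cubeT : uniform_cube [set: _] = 1%E.
Proof.
have cardT : #|` fset_set [set: cube n]|%fset = (2 ^ n)%N.
  rewrite -card_bool -card_tuple cardE.
  apply: perm_size; apply: uniq_perm; [exact: fset_uniq|exact: enum_uniq|move=> x].
  have -> := in_fset_set (finite_finset : finite_set [set: cube n]).
  by rewrite mem_enum in_setT.
rewrite /uniform_cube /mscale /= /counting asboolT; last exact: finite_finset.
by rewrite cardT -EFinM mulVf// pnatr_eq0 expn_eq0.
Qed.

HB.instance Definition _ :=
  Measure_isProbability.Build _ _ _ uniform_cube uniform_cubeT.

Lemma uniform_cube1 (x : cube n) : uniform_cube [set x] = ((2 ^ n)%:R^-1)%:E.
Proof.
rewrite /uniform_cube /mscale /= /counting asboolT; last exact: finite_finset.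
by rewrite fset_set1 cardfs1 mule1.
Qed.

(* - \int log(dmu/dnu) dmu with nu uniform, so it is nonpositive; the junk
   value ln 0 = 0 is only taken on a mu-null set. *)
Definition entropy (mu : probability (cube n) R) : R :=
  - \int[mu]_x ln (fine (('d (charge_of_finite_measure mu) '/d uniform_cube) x)).

Lemma Rintegral_cube (mu : probability (cube n) R) (f : cube n -> R) :
  \int[mu]_x f x = \sum_x f x * fine (mu [set x]).
Proof.
have i1 x : mu.-integrable [set: cube n] (fun y => (\1_[set x] y)%:E).
  by apply: integrable_indic; exact: measurable_cube.
rewrite /Rintegral (eq_integral (fun y => \sum_x (f x)%:E * (\1_[set x] y)%:E)%E).
  rewrite integral_sum//; last by move=> x; exact: (integrableZl measurableT _ (i1 x)).
  rewrite (eq_bigr (fun x => (f x * fine (mu [set x]))%:E)) => [|x _].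
    by rewrite sumEFin.
  rewrite (integralZl measurableT (i1 x)).
  rewrite integral_indic//; last exact: measurable_cube.
  by rewrite setIT EFinM fineK// fin_num_measure//; exact: measurable_cube.
move=> y _; rewrite (bigD1 y)//= big1 ?adde0 => [|x xy].
  by rewrite indicE mem_set// mule1.
by rewrite indicE memNset ?mule0//= => /esym/eqP; rewrite (negbTE xy).
Qed.

Lemma entropyE mu :
  entropy mu = - \sum_x fine (mu [set x]) * ln (2 ^+ n * fine (mu [set x])).
Proof.
have dom : charge_of_finite_measure mu `<< uniform_cube.
  apply/null_content_dominatesP => A _ A0.
  suff -> : A = set0 by exact: (measure0 mu).
  apply/seteqP; split => // x Ax.
  have : (uniform_cube [set x] <= uniform_cube A)%E.
    apply: (le_measure uniform_cube); last by move=> _ ->.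
      by apply/mem_set; exact: measurable_cube.
    by apply/mem_set; exact: measurable_cube.
  by rewrite (A0 : uniform_cube A = 0%E) uniform_cube1 lee_fin leNgt invr_gt0 ltr0n expn_gt0.
have RNE x : fine (('d (charge_of_finite_measure mu) '/d uniform_cube) x) =
    2 ^+ n * fine (mu [set x]).
  have := Radon_Nikodym_integral dom (measurable_cube [set x]).
  rewrite -[X in X = _]/(mu [set x]) => ->.
  rewrite (eq_integral (cst (('d (charge_of_finite_measure mu) '/d uniform_cube) x))); last first.
    by move=> y /set_mem ->.
  rewrite integral_cst; last exact: measurable_cube.
  rewrite -[X in (_ * X)%E]/(uniform_cube [set x]) uniform_cube1.
  rewrite fineM//=; last exact: Radon_Nikodym_fin_num.
  by rewrite natrX mulrCA mulfV ?mulr1// expf_neq0// pnatr_eq0.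
rewrite /entropy; congr (- _).
transitivity (\int[mu]_x ln (2 ^+ n * fine (mu [set x]))).
  by apply: eq_Rintegral => x _; rewrite RNE.
by rewrite Rintegral_cube; apply: eq_bigr => x _; rewrite mulrC.
Qed.

End entropy.

Definition condentropy d (T : measurableType d) (R : realType)
    (P : probability T R) (Sigma : set_system T) n (X : T -> cube n) : \bar R :=
  'E_P[fun w => entropy (condlaw P Sigma X w)].

Definition spin (R : realType) n (x : cube n) (u : 'I_n) : R := (-1) ^+ tnth x u.

(* Average over unordered pairs {u, v} of distinct indices, each represented
   once by u < v; meant for F symmetric. *)
Definition pair_average (R : realType) n (F : 'I_n -> 'I_n -> R) : R :=
  (\sum_(u < n) \sum_(v < n | (u < v)%N) F u v) / 'C(n, 2)%:R.

(* Main.v *)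
(* The embedding is trivial: X is the identity of the cube under its own law,
   and Sigma is generated by finitely many coordinates of X.
   For a partition f of the cube let Psi f = sum_u E[E[X_u | f]^2], a number in
   [0, n]. Since X_v takes two values, refining f by X_v raises Psi by
   sum_u E[Cov(X_u, X_v | f)^2 / Var(X_v | f)], hence by at least
   sum_u E[Cov(X_u, X_v | f)^2]. Averaging over v, some coordinate raises Psi by
   at least n C, where C is the average squared covariance of f over pairs
   u <> v: adding the diagonal does not decrease the average because
   2 Cov(X_u, X_v)^2 <= Var(X_u)^2 + Var(X_v)^2. So C > 1/l can happen at most
   l times in a row, and C <= 1/l is reached by a partition into at most 2^l
   parts. Conditioning on f costs exactly the Shannon entropy of f, which is at
   most l ln 2 <= l. *)
Require Import Defs.
From mathcomp Require Import all_boot all_order all_algebra.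
From mathcomp Require Import all_classical all_reals all_analysis.
From mathcomp Require Import measurable_realfun ring lra.

Set Implicit Arguments.
Unset Strict Implicit.
Unset Printing Implicit Defensive.

Import Order.TTheory GRing.Theory Num.Theory.
Import numFieldNormedType.Exports.

Local Open Scope classical_set_scope.
Local Open Scope ring_scope.

(** * Weighted means and covariances on the fibres of a map *)

Section fibres.
Context (R : realType) (T I : finType) (p : T -> R) (f : T -> I).
Implicit Types (g h : T -> R) (i : I).

Definition fibre_sum g i : R := \sum_(x | f x == i) p x * g x.

Definition fibre_mass i : R := \sum_(x | f x == i) p x.

(* Equal to 0 on fibres of mass 0. *)
Definition fibre_mean g i : R := fibre_sum g i / fibre_mass i.

Definition fibre_cov g h i : R :=
  fibre_mean (g \* h) i - fibre_mean g i * fibre_mean h i.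

(** For a probability weight [p] this is E[E[g | f]^2], the contribution of one coordinate to the
    potential Psi. *)
Definition energy g : R := \sum_i fibre_mass i * fibre_mean g i ^+ 2.

Lemma fibre_meanD g h (c : R) i :
  fibre_mean (fun x => g x + c * h x) i = fibre_mean g i + c * fibre_mean h i.
Proof.
rewrite /fibre_mean mulrA -mulrDl /fibre_sum mulr_sumr -big_split /=.
by congr (_ / _); apply: eq_bigr => x _; rewrite mulrDr mulrCA.
Qed.

Lemma fibre_covC g h i : fibre_cov g h i = fibre_cov h g i.
Proof.
rewrite /fibre_cov mulrC; congr (fibre_mean _ _ - _).
by apply/funext => x /=; rewrite mulrC.
Qed.

Lemma sum_fibre_mass : \sum_i fibre_mass i = \sum_x p x.
Proof. by rewrite [RHS](partition_big f predT). Qed.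

Lemma sum_fibre_sum g : \sum_i fibre_sum g i = \sum_x p x * g x.
Proof. by rewrite [RHS](partition_big f predT). Qed.

(** Lets sums over fibres and weighted sums over points be exchanged for any quantity that depends
    on [f x] only. *)
Lemma sum_fibre (F : I -> R) :
  \sum_i fibre_mass i * F i = \sum_x p x * F (f x).
Proof.
rewrite [RHS](partition_big f predT)//=; apply: eq_bigr => i _.
by rewrite mulr_suml; apply: eq_bigr => x /eqP ->.
Qed.

Hypothesis p_ge0 : forall x, 0 <= p x.

Lemma fibre_mass_ge0 i : 0 <= fibre_mass i.
Proof. exact: sumr_ge0. Qed.

Lemma fibre_mass_gt0 x : 0 < p x -> 0 < fibre_mass (f x).
Proof.
move=> px; rewrite /fibre_mass (bigD1 x)//=.
by apply: ltr_pwDl => //; exact: sumr_ge0.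
Qed.

Lemma fibre_sum_eq0 g i : fibre_mass i = 0 -> fibre_sum g i = 0.
Proof.
move/eqP; rewrite psumr_eq0// => /allP p0.
rewrite /fibre_sum big1// => x fxi.
by have := p0 x (mem_index_enum _); rewrite fxi => /eqP ->; rewrite mul0r.
Qed.

(** On a fibre of positive mass, this variance is the weighted mean of [(g x - mu) ^+ 2]; on a fibre
    of mass 0 every mean is 0 by default. *)
Lemma fibre_cov_ge0 g i : 0 <= fibre_cov g g i.
Proof.
have [m0|m0] := eqVneq (fibre_mass i) 0.
  by rewrite /fibre_cov /fibre_mean m0 invr0 !mulr0 subr0.
set mu := fibre_mean g i.
suff -> : fibre_cov g g i =
    (\sum_(x | f x == i) p x * (g x - mu) ^+ 2) / fibre_mass i.
  apply: divr_ge0; last exact: fibre_mass_ge0.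
  by apply: sumr_ge0 => x _; rewrite mulr_ge0// sqr_ge0.
rewrite (eq_bigr (fun x => p x * (g x * g x) + - (mu *+ 2) * (p x * g x)
    + mu ^+ 2 * p x)); last by move=> x _; ring.
rewrite !big_split /= -!mulr_sumr -/(fibre_mass i) -/(fibre_sum g i).
rewrite -/(fibre_sum (g \* g) i) /fibre_cov -/mu.
have -> : fibre_sum g i = mu * fibre_mass i by rewrite divfK.
by rewrite /fibre_mean; field.
Qed.

(** With variances a, b and covariance c, the variances of g + h and g - h give a + b + 2c >= 0 and
    a + b - 2c >= 0. Their product yields 4c^2 <= (a + b)^2, which is at most 2(a^2 + b^2) because
    (a - b)^2 >= 0. *)
Lemma fibre_cov_sqr_le g h i :
  fibre_cov g h i ^+ 2 *+ 2 <= fibre_cov g g i ^+ 2 + fibre_cov h h i ^+ 2.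
Proof.
have covD c : fibre_cov (fun x => g x + c * h x) (fun x => g x + c * h x) i =
    fibre_cov g g i + c * fibre_cov g h i *+ 2 + c ^+ 2 * fibre_cov h h i.
  rewrite /fibre_cov !fibre_meanD.
  rewrite (_ : _ \* _ = fun x => (fun y => (g \* g) y + (c *+ 2) * (g \* h) y) x
      + c ^+ 2 * (h \* h) x); last by apply/funext => x /=; ring.
  by rewrite !fibre_meanD; ring.
have := fibre_cov_ge0 (fun x => g x + 1 * h x) i.
have := fibre_cov_ge0 (fun x => g x + -1 * h x) i.
have := fibre_cov_ge0 g i; have := fibre_cov_ge0 h i.
rewrite !covD; move: (fibre_cov g h i) (fibre_cov g g i) (fibre_cov h h i).
move=> c a b _ _ h1 h2.
by have := mulr_ge0 h1 h2; have := sqr_ge0 (a - b); nra.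
Qed.

(** On each fibre the squared mean is at most the mean of [g ^+ 2], which is 1, since the variance
    is nonnegative. *)
Lemma energy_le g : (forall x, g x ^+ 2 = 1) -> energy g <= \sum_x p x.
Proof.
move=> g1; rewrite -sum_fibre_mass; apply: ler_sum => i _.
have [->|m0] := eqVneq (fibre_mass i) 0; first by rewrite mul0r.
rewrite ler_piMr ?fibre_mass_ge0//.
have := fibre_cov_ge0 g i; rewrite /fibre_cov subr_ge0 -expr2.
suff -> : fibre_mean (g \* g) i = 1 by [].
rewrite /fibre_mean (_ : fibre_sum _ _ = fibre_mass i) ?divff//.
by apply: eq_bigr => x _; rewrite /= -expr2 g1 mulr1.
Qed.

End fibres.

(** * Energy gained by refining a partition with one bit *)

(** A fibre splits into halves of masses [m1], [m2] on which [g] has weighted sums [M1], [M2]. The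
    energy gain is mass times Cov^2 / Var, where the splitting sign has variance 4 m1 m2 / (m1 +
    m2)^2 <= 1; dropping this variance loses a multiple of (m1 - m2)^2. *)
Lemma energy_split_ineq (R : realType) (m1 m2 M1 M2 : R) :
  0 <= m1 -> 0 <= m2 -> (m1 = 0 -> M1 = 0) -> (m2 = 0 -> M2 = 0) ->
  (m1 + m2) * ((M1 + M2) / (m1 + m2)) ^+ 2 +
  (m1 + m2) * ((M1 - M2) / (m1 + m2) -
    (M1 + M2) / (m1 + m2) * ((m1 - m2) / (m1 + m2))) ^+ 2
  <= m1 * (M1 / m1) ^+ 2 + m2 * (M2 / m2) ^+ 2.
Proof.
move=> m1_ge0 m2_ge0 M10 M20.
(* If a half has mass 0, the covariance vanishes and both sides agree. *)
have [m10|m1n0] := eqVneq m1 0.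
  rewrite m10 M10// !add0r !mul0r add0r.
  have [->|m2n0] := eqVneq m2 0; first by rewrite !mul0r add0r.
  by rewrite le_eqVlt; apply/orP; left; apply/eqP; field.
have [m20|m2n0] := eqVneq m2 0.
  rewrite m20 M20// !addr0 !subr0 !mul0r !addr0.
  by rewrite le_eqVlt; apply/orP; left; apply/eqP; field.
have m1_gt0 : 0 < m1 by rewrite lt_def m1n0.
have m2_gt0 : 0 < m2 by rewrite lt_def m2n0.
have m_gt0 : 0 < m1 + m2 by exact: addr_gt0.
have m_n0 : m1 + m2 != 0 by exact: lt0r_neq0.
rewrite -subr_ge0.
rewrite (_ : _ - _ = (M1 * m2 - M2 * m1) ^+ 2 * (m1 - m2) ^+ 2 /
    (m1 * m2 * (m1 + m2) ^+ 3)); last by field; rewrite m_n0 m1n0 m2n0.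
apply: divr_ge0; first by rewrite mulr_ge0 ?sqr_ge0.
apply: mulr_ge0; first exact: mulr_ge0.
by rewrite exprn_ge0// ltW.
Qed.

Section refinement.
Context (R : realType) (T I : finType) (p : T -> R) (f : T -> I).
Hypothesis p_ge0 : forall x, 0 <= p x.
Variables (b : T -> bool) (g : T -> R).

Let fb x := (f x, b x).
Let h x : R := (-1) ^+ b x.

Let fibre_split (F : T -> R) i :
  \sum_(x | f x == i) F x =
  \sum_(x | fb x == (i, false)) F x + \sum_(x | fb x == (i, true)) F x.
Proof.
rewrite (bigID b) /= addrC; congr (_ + _); apply: eq_bigl => x.
  by rewrite xpair_eqE eqbF_neg.
by rewrite xpair_eqE eqb_id.
Qed.

Let fibre_split_sign (F : T -> R) i :
  \sum_(x | f x == i) F x * h x =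
  \sum_(x | fb x == (i, false)) F x - \sum_(x | fb x == (i, true)) F x.
Proof.
rewrite fibre_split -sumrN; congr (_ + _); apply: eq_bigr => x.
  by rewrite xpair_eqE /h => /andP[_ /eqP ->]; rewrite mulr1.
by rewrite xpair_eqE /h => /andP[_ /eqP ->]; rewrite mulrN1.
Qed.

Lemma energy_refine :
  energy p f g + \sum_i fibre_mass p f i * fibre_cov p f g h i ^+ 2
  <= energy p fb g.
Proof.
rewrite /energy -big_split /=.
rewrite [leRHS](_ : _ = \sum_i \sum_(c : bool)
    fibre_mass p fb (i, c) * fibre_mean p fb g (i, c) ^+ 2); last first.
  by rewrite pair_bigA; apply: eq_bigr => -[].
apply: ler_sum => i _; rewrite big_bool /= addrC.
rewrite /fibre_cov /fibre_mean [in leLHS]/fibre_sum.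
rewrite (fibre_split_sign p).
rewrite (eq_bigr (fun x => (p x * g x) * h x)); last by move=> x _; rewrite mulrA.
rewrite (fibre_split_sign (fun x => p x * g x)).
rewrite /fibre_mass /fibre_sum !(fibre_split _ i) [leRHS]addrC [leLHS]addrC.
apply: energy_split_ineq; try exact: sumr_ge0.
- exact: fibre_sum_eq0.
- exact: fibre_sum_eq0.
Qed.

End refinement.

(** * Energy increment over the coordinates *)

(** Let D be the diagonal sum and O the sum over u < v. Summing the second condition on [F] over all
    u, v gives D + 2O <= nD, so D >= 2O / (n - 1) and D + 2O >= 2nO / (n - 1), which is n^2 times
    the pair average. *)
Lemma pair_average_le (R : realType) (n : nat) (F : 'I_n -> 'I_n -> R) :
  (2 <= n)%N -> (forall u v, F u v = F v u) ->
  (forall u v, F u v *+ 2 <= F u u + F v v) ->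
  n%:R ^+ 2 * pair_average F <= \sum_u \sum_v F u v.
Proof.
move=> n2 Fsym Fdiag.
pose D := \sum_u F u u.
pose O := \sum_(u < n) \sum_(v < n | (u < v)%N) F u v.
have sumE : \sum_u \sum_v F u v = D + O *+ 2.
  have -> : \sum_u \sum_v F u v = \sum_u (F u u +
      (\sum_(v < n | (u < v)%N) F u v + \sum_(v < n | (v < u)%N) F u v)).
    apply: eq_bigr => u _; rewrite (bigD1 u)//=; congr (_ + _).
    rewrite (bigID (fun v : 'I_n => (u < v)%N)) /=.
    by congr (_ + _); apply: eq_bigl => v; rewrite -val_eqE /=; case: ltngtP.
  rewrite !big_split /= mulr2n; congr (_ + (_ + _)).
  rewrite (exchange_big_dep predT)//=; apply: eq_bigr => u _.
  by apply: eq_bigr => v _; exact: Fsym.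
have Dle : D + O *+ 2 <= n%:R * D.
  rewrite -sumE -(ler_pMn2r (n := 2))//.
  rewrite -sumrMnl; under eq_bigr do rewrite -sumrMnl.
  apply: (@le_trans _ _ (\sum_u \sum_v (F u u + F v v))).
    by apply: ler_sum => u _; apply: ler_sum => v _; exact: Fdiag.
  under eq_bigr do rewrite big_split /= sumr_const card_ord.
  by rewrite big_split /= sumr_const card_ord sumrMnl -/D mulr_natl mulr2n.
have CE : 'C(n, 2)%:R * 2 = n%:R * (n%:R - 1) :> R.
  case: n n2 {F Fsym Fdiag D O sumE Dle} => // k _.
  have /(congr1 (fun m => m%:R : R)) := mul_bin_diag k.+1 1.
  by rewrite bin1 !natrM /= => binE; rewrite mulrC -binE -natr1; ring.
have n1 : 1 < n%:R :> R by rewrite ltr1n.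
have C0 : 0 < 'C(n, 2)%:R :> R by rewrite ltr0n bin_gt0.
rewrite sumE /pair_average -/O mulrA ler_pdivrMr//.
rewrite -(ler_pM2r (x := 2))// -[leRHS]mulrA CE.
move: n1 Dle; move: (n%:R : R) => N; clearbody D O => N1 Dle.
by rewrite -subr_ge0; nra.
Qed.

Lemma exists_decorrelating_partition (R : realType) (T : finType) (p : T -> R)
    (n : nat) (b : 'I_n -> T -> bool) (l : nat) :
  (2 <= n)%N -> (0 < l)%N -> (forall x, 0 <= p x) -> \sum_x p x = 1 ->
  let g u x : R := (-1) ^+ b u x in
  exists (I : finType) (f : T -> I), (#|I| <= 2 ^ l)%N /\
    \sum_x p x * pair_average (fun u v => fibre_cov p f (g u) (g v) (f x) ^+ 2)
      <= l%:R^-1.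
Proof.
move=> n2 l0 p0 p1 g.
pose C (I : finType) (f : T -> I) := \sum_x p x *
  pair_average (fun u v => fibre_cov p f (g u) (g v) (f x) ^+ 2).
pose Psi (I : finType) (f : T -> I) := \sum_u energy p f (g u).
have n_gt0 : 0 < n%:R :> R by rewrite ltr0n; case: n n2 {b g C Psi}.
have l_gt0 : 0 < l%:R :> R by rewrite ltr0n.
have step (I : finType) (f : T -> I) : l%:R^-1 < C I f ->
    exists v, Psi I f + n%:R / l%:R < Psi _ (fun x => (f x, b v x)).
  (* If no coordinate raised Psi by more than n / l, the total gain over all v would be at most n^2
     / l. That total is at least n^2 times [C I f], contradicting [Cl]. *)
  move=> Cl; apply/not_existsP => small.
  suff : n%:R ^+ 2 * C I f <= n%:R ^+ 2 * l%:R^-1.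
    by rewrite ler_pM2l ?exprn_gt0// leNgt Cl.
  apply: (@le_trans _ _ (\sum_v \sum_u \sum_i
      fibre_mass p f i * fibre_cov p f (g u) (g v) i ^+ 2)).
    rewrite /C -(sum_fibre _ _ (fun i => pair_average
      (fun u v => fibre_cov p f (g u) (g v) i ^+ 2))) mulr_sumr.
    under [leRHS]eq_bigr do rewrite exchange_big /=.
    rewrite exchange_big /=; apply: ler_sum => i _; rewrite mulrCA.
    under [leRHS]eq_bigr do rewrite -mulr_sumr.
    rewrite -mulr_sumr ler_wpM2l ?fibre_mass_ge0//.
    rewrite [leRHS]exchange_big; apply: pair_average_le => // u v.
      by rewrite fibre_covC.
    exact: fibre_cov_sqr_le.
  have -> : n%:R ^+ 2 * l%:R^-1 = \sum_(v < n) n%:R / l%:R :> R.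
    by rewrite sumr_const card_ord -[RHS]mulr_natl mulrA.
  apply: ler_sum => v _; have /negP := small v; rewrite -leNgt => Psi_le.
  rewrite -(lerD2l (Psi I f)); apply: le_trans Psi_le.
  by rewrite /Psi -big_split; apply: ler_sum => u _; exact: energy_refine.
(* Starting from the one-part partition, each round either already has a good partition or doubles
   the number of parts and raises Psi by n / l. *)
have dich t : (exists (I : finType) (f : T -> I),
    (#|I| <= 2 ^ t)%N /\ C I f <= l%:R^-1) \/
  (exists (I : finType) (f : T -> I),
    (#|I| <= 2 ^ t)%N /\ t%:R * (n%:R / l%:R) <= Psi I f).
  elim: t => [|t [[I [f [cI fC]]]|[I [f [cI fPsi]]]]].
  - right; exists unit, (fun=> tt); split; first by rewrite card_unit.
    rewrite mul0r; apply: sumr_ge0 => u _; apply: sumr_ge0 => i _.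
    by rewrite mulr_ge0 ?sqr_ge0 ?fibre_mass_ge0.
  - by left; exists I, f; split => //; rewrite (leq_trans cI)// leq_pexp2l.
  - have [Cle|/step[v vPsi]] := leP (C I f) l%:R^-1.
      by left; exists I, f; split => //; rewrite (leq_trans cI)// leq_pexp2l.
    right; exists (I * bool)%type, (fun x => (f x, b v x)); split.
      by rewrite card_prod card_bool expnS mulnC leq_mul2l cI.
    apply: le_trans (ltW vPsi).
    by rewrite -natr1 mulrDl mul1r lerD2r.
have [//|[I [f [cI fPsi]]]] := dich l.
(* After [l] rounds Psi is at least n. One further increment would exceed n, the upper bound given
   by [energy_le], so this partition is good too. *)
exists I, f; split => //; rewrite leNgt; apply/negP => /step[v].
apply/negP; rewrite -leNgt.
apply: (@le_trans _ _ n%:R); last first.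
  rewrite -[leLHS]addr0 lerD ?divr_ge0//.
  by rewrite mulrCA divff ?mulr1 ?gt_eqF// in fPsi.
apply: (@le_trans _ _ (\sum_(u < n) 1)); last first.
  by rewrite sumr_const card_ord.
apply: ler_sum => u _; rewrite -p1; apply: energy_le => // x.
by rewrite /g sqrr_sign.
Qed.

(** * Shannon entropy of a partition *)

(** Gibbs' inequality against the uniform law on [I]: with [w] the ratio of the uniform law to the
    law of [f], ln w <= w - 1, and the mean of [w] is at most 1. *)
Lemma fibre_entropy_le (R : realType) (T I : finType) (p : T -> R) (f : T -> I) :
  (forall x, 0 <= p x) -> \sum_x p x = 1 ->
  - \sum_x p x * ln (fibre_mass p f (f x)) <= ln #|I|%:R.
Proof.
move=> p0 p1.
have I_gt0 : 0 < #|I|%:R :> R.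
  rewrite ltr0n; apply/card_gt0P; case: (pickP (fun _ : T => true)) => [x _|T0].
    by exists (f x).
  by move: p1; rewrite big_pred0// => /esym/eqP; rewrite oner_eq0.
rewrite -subr_ge0.
pose w i : R := (#|I|%:R * fibre_mass p f i)^-1.
apply: (@le_trans _ _ (\sum_x p x * (1 - w (f x)))); last first.
  rewrite opprK; have -> : ln #|I|%:R + \sum_x p x * ln (fibre_mass p f (f x)) =
      \sum_x p x * (ln #|I|%:R + ln (fibre_mass p f (f x))).
    under [RHS]eq_bigr do rewrite mulrDr.
    by rewrite big_split /= -mulr_suml p1 mul1r.
  apply: ler_sum => x _.
  have [->|px] := eqVneq (p x) 0; first by rewrite !mul0r.
  have m_gt0 : 0 < fibre_mass p f (f x).
    by apply: fibre_mass_gt0 => //; rewrite lt_def px p0.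
  rewrite ler_wpM2l// -lnM ?posrE// -[leRHS]opprK -lnV ?posrE ?mulr_gt0//.
  rewrite -/(w (f x)) -lerN2 opprK opprB.
  rewrite -{1}[w (f x)](subrK 1) addrC.
  apply: le_ln1Dx; rewrite ltrBrDl subrr /w invr_gt0 mulr_gt0//.
rewrite -(sum_fibre p f (fun i => 1 - w i)).
under eq_bigr do rewrite mulrBr mulr1.
rewrite sumrB sum_fibre_mass p1 subr_ge0.
apply: (@le_trans _ _ (\sum_(i : I) #|I|%:R^-1)).
  apply: ler_sum => i _; rewrite /w.
  (* Fibres of mass 0 contribute 0 instead of 1 / #|I|, hence an inequality rather than an
     equality. *)
  have [->|m0] := eqVneq (fibre_mass p f i) 0.
    by rewrite mul0r invr_ge0 ltW.
  by rewrite invfM mulrCA divff// mulr1.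
by rewrite sumr_const -[leLHS]mulr_natl divff// gt_eqF.
Qed.

(** * Integration on the cube as finite sums *)

Section cube_law.
Context (R : realType) (n : nat) (P : probability (cube n) R).
Implicit Types (g : cube n -> R) (A : set (cube n)).

Definition point_mass (x : cube n) : R := fine (P [set x]).

Lemma point_mass_ge0 x : 0 <= point_mass x.
Proof. exact: fine_ge0. Qed.

Lemma sum_point_mass : \sum_x point_mass x = 1.
Proof.
have := Rintegral_cube P (cst 1).
rewrite Rintegral_cst//= mul1r [fine _](_ : _ = 1); last by rewrite probability_setT.
by move=> ->; apply: eq_bigr => x _; rewrite mul1r.
Qed.

Lemma measurable_cube_fun g : measurable_fun setT g.
Proof. by move=> _ B _; exact: measurable_cube. Qed.

Lemma integrable_cube A g : P.-integrable A (EFin \o g).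
Proof.
have mA : measurable A by exact: measurable_cube.
apply: measurable_bounded_integrable => //.
- by apply: le_lt_trans (probability_le1 P mA) _; rewrite ltry.
- by apply: measurable_funTS; exact: measurable_cube_fun.
exists (\sum_x `|g x|); split; first exact: num_real.
move=> M gM x _; apply: le_trans (ltW gM).
by rewrite (bigD1 x)//= lerDl sumr_ge0.
Qed.

Lemma integral_cube A g : (\int[P]_(x in A) (g x)%:E)%E =
  (\sum_(x | x \in A) point_mass x * g x)%:E.
Proof.
rewrite integral_mkcond.
rewrite (eq_integral (EFin \o (fun x => \1_A x * g x))); last first.
  by move=> x _; rewrite patchE /= indicE; case: ifP; rewrite ?mul1r ?mul0r.
rewrite -[LHS]fineK ?integrable_fin_num//; last exact: integrable_cube.
congr EFin; rewrite [LHS](Rintegral_cube P) [RHS]big_mkcond.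
apply: eq_bigr => x _; rewrite indicE /point_mass.
by case: ifP; rewrite ?mul1r ?mul0r// mulrC.
Qed.

Lemma expectation_cube g : ('E_P[g])%E = (\sum_x point_mass x * g x)%:E.
Proof.
rewrite unlock integral_cube; congr EFin; apply: eq_bigl => x.
by rewrite in_setT.
Qed.

(** A null set contains no atom. This turns almost sure uniqueness of conditional expectations and
    laws into pointwise formulas. *)
Lemma ae_cube (Q : cube n -> Prop) : {ae P, forall x, Q x} ->
  forall x, 0 < point_mass x -> Q x.
Proof.
move=> [N [mN N0 subN]] x; rewrite ltNge => /negP px; apply: contrapT => nQ.
apply: px; rewrite -lee_fin fineK ?fin_num_measure//; last exact: measurable_cube.
rewrite -[leRHS]N0; apply: le_measure => //; rewrite ?inE//; first exact: measurable_cube.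
by move=> _ ->; exact: subN.
Qed.

End cube_law.

(** * Conditioning on the sigma-algebra of a partition *)

(** The unions of fibres of [f]; for finite [I] this is the sigma-algebra generated by [f] with [I]
    discrete. *)
Definition fibre_algebra (T I : Type) (f : T -> I) : set_system T :=
  [set A | forall x y, f x = f y -> A x -> A y].

Lemma sigma_algebra_fibre (T I : Type) (f : T -> I) :
  sigma_algebra [set: T] (fibre_algebra f).
Proof.
split => [//|A Af x y fxy [_ nAx]|F Ff x y fxy [i _ Fix]].
  by split => // Ay; apply: nAx; exact: Af Ay.
by exists i => //; exact: Ff Fix.
Qed.

Section fibre_condexp.
Context (R : realType) (n : nat) (P : probability (cube n) R).
Context (I : finType) (f : cube n -> I).

Let p := point_mass P.

Lemma sub_sigma_algebra_fibre :
  is_sub_sigma_algebra (fibre_algebra f : set_system (cube n)).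
Proof.
by split => [|A _]; [exact: sigma_algebra_fibre|exact: measurable_cube].
Qed.

Lemma is_condexp_fibre_mean (g : cube n -> R) :
  is_condexp P (fibre_algebra f) g (fibre_mean p f g \o f).
Proof.
split; last 2 first.
- exact: integrable_cube.
- move=> A Af; rewrite !integral_cube; congr EFin.
  rewrite (partition_big f predT)//= [RHS](partition_big f predT)//=.
  apply: eq_bigr => i _.
  (* A fibre either misses [A] or lies inside it, so the integrals can be compared fibre by
     fibre. *)
  have [[y yA <-]|noA] := pselect (exists2 y, A y & f y = i); last first.
    by rewrite !big1// => x /andP[/set_mem xA /eqP fx]; case: noA; exists x.
  have Ay x : (x \in A) && (f x == f y) = (f x == f y).
    apply/andP/idP => [[]//|/eqP fxy]; rewrite fxy eqxx; split => //.
    by apply/mem_set; apply: Af yA.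
  rewrite !(eq_bigl _ _ Ay).
  transitivity (fibre_mass p f (f y) * fibre_mean p f g (f y)).
    by rewrite mulr_suml; apply: eq_bigr => x /eqP ->.
  rewrite -[RHS]/(fibre_sum p f g (f y)) /fibre_mean.
  have [m0|m0] := eqVneq (fibre_mass p f (f y)) 0; last by rewrite mulrC divfK.
  by rewrite m0 mul0r fibre_sum_eq0//; exact: point_mass_ge0.
- move=> _ B mB; rewrite setTI.
  rewrite [X in X _](measurable_g_measurableTypeE (sigma_algebra_fibre f)).
  by move=> x y fxy; rewrite /= fxy.
Qed.

Lemma condexp_fibre (g : cube n -> R) x : 0 < p x ->
  condexp P (fibre_algebra f) g x = fibre_mean p f g (f x).
Proof.
have := condexp_ae_eq sub_sigma_algebra_fibre
  (condexpP sub_sigma_algebra_fibre (integrable_cube P setT g))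
  (is_condexp_fibre_mean g).
by move=> /ae_cube; exact.
Qed.

Lemma condcov_fibre (g h : cube n -> R) x : 0 < p x ->
  condcov P (fibre_algebra f) g h x = fibre_cov p f g h (f x).
Proof. by move=> px; rewrite /condcov !condexp_fibre. Qed.

Lemma condlaw_fibre x y : 0 < p x ->
  fine (condlaw P (fibre_algebra f) id x [set y]) =
  (f y == f x)%:R * (p y / fibre_mass p f (f x)).
Proof.
move=> px; have mid : measurable_fun [set: cube n] (@id (cube n)) by [].
have my : measurable [set y] by exact: measurable_cube.
have := condexp_ae_eq sub_sigma_algebra_fibre
  (condlawP P mid sub_sigma_algebra_fibre my) (is_condexp_fibre_mean _).
move=> /ae_cube /(_ x px) ->; rewrite /= /fibre_mean mulrA; congr (_ / _).
rewrite /fibre_sum big_mkcond (bigD1 y)//= big1 ?addr0.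
  by rewrite indicE mem_set// mulr1; case: ifP; rewrite ?mul1r ?mul0r.
move=> z zy; rewrite indicE memNset ?mulr0 ?if_same//= => zy'.
by rewrite zy' eqxx in zy.
Qed.

Lemma entropy_condlaw x : 0 < p x ->
  entropy (condlaw P (fibre_algebra f) id x) =
  - fibre_mean p f (fun y => ln (2 ^+ n * (p y / fibre_mass p f (f x)))) (f x).
Proof.
move=> px; rewrite entropyE; congr (- _).
rewrite /fibre_mean mulr_suml [RHS]big_mkcond; apply: eq_bigr => y _.
rewrite condlaw_fibre//; case: ifP => _; last by rewrite !mul0r.
by rewrite !mul1r mulrAC.
Qed.

(** The chain rule: inside a fibre the law has density 2^n p / mass relative to the uniform measure,
    and splitting the logarithm leaves the entropy of the whole law minus the Shannon entropy of
    [f]. *)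
Lemma condentropy_fibre :
  condentropy P (fibre_algebra f) id =
  (- (\sum_x p x * ln (2 ^+ n * p x)) + \sum_x p x * ln (fibre_mass p f (f x)))%:E.
Proof.
have p0 := point_mass_ge0 P.
rewrite /condentropy expectation_cube -/p; congr EFin.
(* Writing the mass at [f y] instead of [f x], which is the same on the fibre, makes the averaged
   function independent of [x], so total expectation applies. *)
transitivity (\sum_x p x * - fibre_mean p f
    (fun y => ln (2 ^+ n * (p y / fibre_mass p f (f y)))) (f x)).
  apply: eq_bigr => x _; have [->|px] := eqVneq (p x) 0; first by rewrite !mul0r.
  rewrite entropy_condlaw ?lt_def ?px ?p0//; congr (_ * - (_ / _)).
  by apply: eq_bigr => y /eqP ->.
rewrite -(sum_fibre p f (fun i => - fibre_mean p f
  (fun y => ln (2 ^+ n * (p y / fibre_mass p f (f y)))) i)).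
transitivity (- \sum_i fibre_sum p f
    (fun y => ln (2 ^+ n * (p y / fibre_mass p f (f y)))) i).
  rewrite -sumrN; apply: eq_bigr => i _; rewrite mulrN /fibre_mean; congr (- _).
  have [m0|m0] := eqVneq (fibre_mass p f i) 0; last by rewrite mulrC divfK.
  by rewrite m0 mul0r fibre_sum_eq0.
rewrite sum_fibre_sum.
rewrite -!sumrN -big_split /=; apply: eq_bigr => x _.
have [->|px] := eqVneq (p x) 0; first by rewrite !mul0r oppr0 addr0.
have px_gt0 : 0 < p x by rewrite lt_def px p0.
have m_gt0 : 0 < fibre_mass p f (f x) by exact: fibre_mass_gt0.
rewrite mulrA lnM ?posrE ?invr_gt0 ?mulr_gt0 ?exprn_gt0// lnV ?posrE//.
by rewrite mulrDr mulrN opprD opprK.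
Qed.

End fibre_condexp.

(** * Assembly on the cube under the law of the vector *)

Theorem corollary4 (R : realType) (n : nat) (n_ge2 : (2 <= n)%N)
    (d : measure_display) (T : measurableType d) (P : probability T R)
    (X : {RV P >-> cube n}) :
  exists (d' : measure_display) (T' : measurableType d') (P' : probability T' R)
      (X' : {RV P' >-> cube n}),
    distribution P' X' = distribution P X /\
    forall l : nat, (1 <= l <= n)%N ->
      exists2 Sigma : set_system T', is_sub_sigma_algebra Sigma &
        ('E_P'[(fun w => pair_average (fun u v =>
            condcov P' Sigma (fun w' => spin R (X' w') u)
                             (fun w' => spin R (X' w') v) w ^+ 2))%R]
          <= (l%:R^-1)%:E)%E /\
        ((entropy (distribution P' X'))%:E - condentropy P' Sigma X' <= l%:R%:E)%E.
Proof.
pose Q : probability (cube n) R := distribution P X.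
have mid : measurable_fun [set: cube n] (@id (cube n)) by [].
pose Y : {RV Q >-> cube n} := mfun_Sub (mem_set mid).
exists _, (cube n), Q, Y; split => [//|l /andP[l_gt0 _]].
pose p := point_mass Q.
have p0 : forall x, 0 <= p x := point_mass_ge0 Q.
have p1 : \sum_x p x = 1 := sum_point_mass Q.
have [I [f [cardI covI]]] :=
  exists_decorrelating_partition (fun u x => tnth x u) n_ge2 l_gt0 p0 p1.
exists (fibre_algebra f); first exact: sub_sigma_algebra_fibre.
split.
  rewrite expectation_cube lee_fin; apply: le_trans covI.
  rewrite le_eqVlt; apply/orP; left; apply/eqP; apply: eq_bigr => x _.
  (* The chosen versions of the conditional covariances are determined only at points of positive
     mass; the others have weight 0. *)
  rewrite -/p; have [->|px] := eqVneq (p x) 0; first by rewrite !mul0r.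
  congr (_ * pair_average _); apply/funext => u; apply/funext => v.
  by rewrite condcov_fibre// lt_def px p0.
rewrite -[condentropy _ _ _]/(condentropy Q (fibre_algebra f) id).
rewrite condentropy_fibre -/p.
have -> : entropy (distribution Q Y) = - \sum_x p x * ln (2 ^+ n * p x).
  exact: entropyE.
(* The entropies of the full law cancel, leaving the Shannon entropy of [f]. *)
rewrite -EFinB lee_fin opprD opprK addrA addNr add0r.
apply: (le_trans (fibre_entropy_le f p0 p1)).
apply: (@le_trans _ _ (ln (2 ^+ l))).
  rewrite ler_ln ?posrE ?exprn_gt0//.
    by rewrite -natrX ler_nat.
  by rewrite ltr0n; apply/card_gt0P; exists (f point).
rewrite lnXn// -[leLHS]mulr_natl ler_piMr//.
(* The bound ln 2 <= 1 is ln (1 + x) <= x at x = 1. *)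
have := @le_ln1Dx R 1; rewrite -[1 + 1]/(2%:R); apply.
by rewrite (lt_trans (ltrN10 _)) ?ltr01.
Qed.
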